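(* The Hilbert cube $[0,1]^{\mathbb{N}}$ (with the product topology) can be topologically embedded into $\mathcal{X}$.
   Context: Box metric space: a metric measure space $(X,d_X,\mu_X)$ is a complete separable metric space $(X,d_X)$ with a Borel probability measure $\mu_X$; one always assumes $X=\operatorname{supp}\mu_X$. Two metric measure spaces are mm-isomorphic if there is an isometry $f\colon \operatorname{supp}\mu_X\to\operatorname{supp}\mu_Y$ (onto) with $f_*\mu_X=\mu_Y$. $\Pi(\mu_X,\mu_Y)$ is the set of couplings, i.e. Borel measures on $X\times Y$ with marginals $\mu_X$ and $\mu_Y$. For $S\subset X\times Y$, $\operatorname{dis} S=\sup\{|d_X(x_1,x_2)-d_Y(y_1,y_2)| : (x_1,y_1),(x_2,y_2)\in S\}$ (with $\operatorname{dis}\emptyset=0$). The box distance is $\square(X,Y)=\min_{\pi\in\Pi(\mu_X,\mu_Y)}\min_{S}\max\{1-\pi(S),\operatorname{dis}S\}$, where $S$ ranges over all closed subsets of $X\times Y$. $\mathcal{X}$ is the metric space of mm-isomorphism classes of metric measure spaces with the metric $\square$. *)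

(* Defs.v *)
From HB Require Import structures.
From mathcomp Require Import all_boot all_order all_algebra.
From mathcomp Require Import generic_quotient.
From mathcomp Require Import all_classical all_reals all_analysis.

Set Implicit Arguments.
Unset Strict Implicit.
Unset Printing Implicit Defensive.

Import Order.TTheory GRing.Theory Num.Theory.
Import numFieldNormedType.Exports.
Local Open Scope classical_set_scope.
Local Open Scope ring_scope.

Notation borel T := (g_sigma_algebraType (@open T)).

Definition separable (T : topologicalType) :=
  exists2 D : set T, countable D & dense D.

Definition complete_space (T : uniformType) :=
  forall F : set_system T, ProperFilter F -> cauchy F -> exists x : T, F --> x.

Definition supp (R : realType) (T : topologicalType)
    (m : set (borel T) -> \bar R) : set T :=
  [set x | forall U : set T, open_nbhs x U -> (0 < m U)%E].

(* A metric space as raw data on a bare Type: a record with a field of type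
   metricType R lives in a universe too large to be itself the carrier of a
   topologicalType, as the space of all metric measure spaces has to be.  No
   space is lost: every separable metric space has a copy in Set.  The base point
   is there because measurable types are pointed; it is arbitrary, and mm_iso
   below ignores it. *)
Record metricSpace (R : realType) := MetricSpace {
  ms_carrier :> Type ;
  ms_point : ms_carrier ;
  ms_dist : ms_carrier -> ms_carrier -> R ;
  ms_distxx : forall x, ms_dist x x = 0 ;
  ms_positivity : forall x y, ms_dist x y = 0 -> x = y ;
  ms_sym : forall x y, ms_dist x y = ms_dist y x ;
  ms_triangle : forall y x z, ms_dist x z <= ms_dist x y + ms_dist y z
}.

HB.instance Definition _ (R : realType) (X : metricSpace R) :=
  gen_eqMixin (ms_carrier X).
HB.instance Definition _ (R : realType) (X : metricSpace R) :=
  gen_choiceMixin (ms_carrier X).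
HB.instance Definition _ (R : realType) (X : metricSpace R) :=
  isPointed.Build (ms_carrier X) (ms_point X).
HB.instance Definition _ (R : realType) (X : metricSpace R) :=
  isMetric.Build R (ms_carrier X) (@ms_distxx R X) (@ms_positivity R X)
    (@ms_sym R X) (@ms_triangle R X).

Record mmSpace (R : realType) := MMSpace {
  mm_space :> metricSpace R ;
  mm_complete : complete_space mm_space ;
  mm_separable : separable mm_space ;
  mm_mu : probability (borel mm_space) R ;
  mm_full : supp mm_mu = [set: mm_space]
}.

Section box.
Context {R : realType}.
Implicit Types X Y : mmSpace R.

Definition mm_iso X Y := exists f : X -> Y,
  [/\ forall x x' : X, mdist (f x) (f x') = mdist x x',
      set_surj [set: X] [set: Y] f &
      forall A : set (borel Y), measurable A ->
        pushforward (mm_mu X) (f : borel X -> borel Y) A = mm_mu Y A].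

Definition coupling X Y (p : {measure set (borel (X * Y)%type) -> \bar R}) :=
  (forall A : set (borel X), measurable A ->
     pushforward p (fst : borel (X * Y)%type -> borel X) A = mm_mu X A) /\
  (forall B : set (borel Y), measurable B ->
     pushforward p (snd : borel (X * Y)%type -> borel Y) B = mm_mu Y B).

(* The adjoined 0 only matters for S = set0, where ereal_sup would be -oo. *)
Definition dis X Y (S : set (X * Y)) : \bar R :=
  ereal_sup (0%E |` [set (`|mdist p.1 q.1 - mdist p.2 q.2|)%:E
                    | p in S & q in S]).

(* An infimum in place of the minimum of the mathematical definition: the
   minimum is attained, so the value is the same. *)
Definition box X Y : \bar R :=
  ereal_inf [set r | exists (p : {measure set (borel (X * Y)%type) -> \bar R})
                            (S : set (X * Y)),
    [/\ coupling p, closed S & r = maxe (1 - p S)%E (dis S)]].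

End box.

Section quotient.
Context {R : realType}.
Implicit Types X Y Z : mmSpace R.

Lemma isometry_continuous X Y (f : X -> Y) :
  (forall x x', mdist (f x) (f x') = mdist x x') -> continuous f.
Proof.
move=> fd x A /nbhs_ballP[e e0 eA]; apply/nbhs_ballP; exists e => // y.
by rewrite ballEmdist/= => xy; apply: eA; rewrite ballEmdist/= fd.
Qed.

Lemma isometry_inj X Y (f : X -> Y) :
  (forall x x', mdist (f x) (f x') = mdist x x') -> injective f.
Proof.
by move=> fd x y xy; apply: (@mdist_positivity R); rewrite -fd xy mdistxx.
Qed.

Lemma continuous_borel (T U : topologicalType) (f : T -> U) :
  continuous f -> forall A : set U, <<s open >> A -> <<s open >> (f @^-1` A).
Proof.
move=> /continuousP fc A.
suff : <<s open >> `<=` [set A | <<s open >> (f @^-1` A)] by exact.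
apply: smallest_sub; last first.
  by move=> B oB; apply: sub_gen_smallest; exact: fc.
split.
- by rewrite /= preimage_set0; exact: sigma_algebra0.
- by move=> B /= sB; rewrite setTD preimage_setC -setTD; exact: sigma_algebraCD.
- by move=> F /= sF; rewrite preimage_bigcup; exact: sigma_algebra_bigcup.
Qed.

Lemma mm_iso_refl X : mm_iso X X.
Proof. by exists id; split=> // x _; exists x. Qed.

Lemma mm_isoE X Y : mm_iso X Y -> exists (f : X -> Y) (g : Y -> X),
  [/\ cancel f g, cancel g f, (forall x x', mdist (f x) (f x') = mdist x x'),
      (forall y y', mdist (g y) (g y') = mdist y y') &
      forall A : set (borel Y), measurable A -> mm_mu X (f @^-1` A) = mm_mu Y A].
Proof.
case=> f [fd fs fm].
have /choice [g fK] : forall y, exists x, f x = y.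
  by move=> y; have [x _ <-] := fs y I; exists x.
have gd y y' : mdist (g y) (g y') = mdist y y' by rewrite -fd !fK.
by exists f, g; split=> // x; apply: (isometry_inj fd); rewrite fK.
Qed.

Lemma mm_iso_sym X Y : mm_iso X Y -> mm_iso Y X.
Proof.
move=> /mm_isoE[f [g [fK gK fd gd fm]]].
exists g; split=> // [x _|A mA]; first by exists (f x).
rewrite /pushforward -fm; last first.
  exact: (continuous_borel (isometry_continuous gd) mA).
by congr (mm_mu X _); apply/seteqP; split=> x /=; rewrite fK.
Qed.

Lemma mm_iso_trans Y X Z : mm_iso X Y -> mm_iso Y Z -> mm_iso X Z.
Proof.
case=> f [fd fs fm] [g [gd gs gm]]; exists (g \o f); split.
- by move=> x x' /=; rewrite gd fd.
- by move=> z _; have [y _ <-] := gs z I; have [x _ <-] := fs y I; exists x.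
- move=> A mA; rewrite -gm// /pushforward -fm//.
  exact: (continuous_borel (isometry_continuous gd) mA).
Qed.

Lemma pair_continuous (T T' U U' : topologicalType) (f : T -> T') (g : U -> U') :
  continuous f -> continuous g ->
  continuous ((fun z => (f z.1, g z.2)) : T * U -> T' * U').
Proof.
move=> fc gc z A [[B C] /= [nB nC] BCA].
exists (f @^-1` B, g @^-1` C); first by split; [exact: fc | exact: gc].
by move=> [x y] [/= Bx Cy]; apply: BCA.
Qed.

Lemma box_iso_le X X' Y Y' : mm_iso X X' -> mm_iso Y Y' ->
  (box X' Y' <= box X Y)%E.
Proof.
move=> /mm_isoE [f [f' [fK f'K fd f'd fm]]] /mm_isoE [g [g' [gK g'K gd g'd gm]]].
apply: le_ereal_inf => _ [p [S [[pX pY] cS ->]]].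
pose h (z : X * Y) := (f z.1, g z.2).
pose k (z : X' * Y') := (f' z.1, g' z.2).
have hc : continuous h.
  by apply: pair_continuous; exact: isometry_continuous.
have kc : continuous k.
  by apply: pair_continuous; exact: isometry_continuous.
have mh : measurable_fun [set: borel (X * Y)%type]
    (h : borel (X * Y)%type -> borel (X' * Y')%type).
  by move=> _ A mA; rewrite setTI; exact: (continuous_borel hc).
pose q : {measure set (borel (X' * Y')%type) -> \bar R} :=
  @measure_function_pushforward__canonical__measure_function_Measure
    _ _ (borel (X * Y)%type) (borel (X' * Y')%type) _ p h mh.
pose S' := k @^-1` S.
have qS : q S' = p S.
  rewrite /q/= /pushforward; congr (p _).
  by apply/seteqP; split=> -[x y]; rewrite /S'/k/h/= fK gK.
exists q, S'; split.
- split=> A mA; rewrite /pushforward /q/= /pushforward.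
  + rewrite -fm// -pX /pushforward//.
    exact: (continuous_borel (isometry_continuous fd) mA).
  + rewrite -gm// -pY /pushforward//.
    exact: (continuous_borel (isometry_continuous gd) mA).
- by apply: closed_comp => // z _; exact: kc.
- rewrite qS; congr (maxe _ _); rewrite /dis; congr (ereal_sup (_ |` _)).
  apply/seteqP; split=> r.
    move=> [z Sz [w Sw <-]]; exists (h z).
      by rewrite /S'/k/h/= fK gK; case: z Sz.
    exists (h w); first by rewrite /S'/k/h/= fK gK; case: w Sw.
    by rewrite /h/= fd gd.
  by move=> [z Sz [w Sw <-]]; exists (k z) => //; exists (k w) => //; rewrite f'd g'd.
Qed.

Lemma box_iso X X' Y Y' : mm_iso X X' -> mm_iso Y Y' -> box X Y = box X' Y'.
Proof.
move=> XX' YY'; apply/le_anti; rewrite (box_iso_le XX' YY') andbT.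
by apply: box_iso_le; exact: mm_iso_sym.
Qed.

End quotient.

HB.instance Definition _ (R : realType) := gen_eqMixin (mmSpace R).
HB.instance Definition _ (R : realType) := gen_choiceMixin (mmSpace R).

Section mm_class.
Context (R : realType).

Definition mm_isob : rel (mmSpace R) := fun X Y => `[< mm_iso X Y >].

Lemma mm_isob_refl : reflexive mm_isob.
Proof. by move=> X; apply/asboolP; exact: mm_iso_refl. Qed.

Lemma mm_isob_sym : symmetric mm_isob.
Proof. by move=> X Y; apply/asboolP/asboolP; exact: mm_iso_sym. Qed.

Lemma mm_isob_trans : transitive mm_isob.
Proof.
by move=> Y X Z /asboolP XY /asboolP YZ; apply/asboolP; exact: mm_iso_trans YZ.
Qed.

Canonical mm_isob_equiv := EquivRel _ mm_isob_refl mm_isob_sym mm_isob_trans.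

Definition mm_class := {eq_quot mm_isob_equiv}%qT.

HB.instance Definition _ := Choice.on mm_class.
HB.instance Definition _ := Quotient.on mm_class.

Definition mm_class_of (X : mmSpace R) : mm_class := (\pi_mm_class X)%qT.

Lemma mm_class_ofP X Y : mm_class_of X = mm_class_of Y <-> mm_iso X Y.
Proof.
split=> [/eqP|XY]; first by rewrite piE => /asboolP.
by apply/eqP; rewrite piE; apply/asboolP.
Qed.

(* Independent of the representatives, see class_boxE. *)
Definition class_box (x y : mm_class) : \bar R := box (repr x) (repr y).

Lemma class_boxE X Y : class_box (mm_class_of X) (mm_class_of Y) = box X Y.
Proof. by apply: box_iso; apply/mm_class_ofP; rewrite /mm_class_of reprK. Qed.

(* The metric topology of class_box, defined from its balls; its open sets make
   a topology without any appeal to the triangle inequality. *)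
Definition class_box_open (U : set mm_class) :=
  forall x, U x -> exists2 e : R, 0 < e &
    forall y, (class_box x y < e%:E)%E -> U y.

Lemma class_box_openT : class_box_open setT.
Proof. by move=> x _; exists 1. Qed.

Lemma class_box_openI : setI_closed class_box_open.
Proof.
move=> U V oU oV x [/oU[e e0 eU] /oV[d d0 dV]].
exists (Num.min e d); first by rewrite lt_min e0.
move=> y xy; split; [apply: eU|apply: dV]; apply: (lt_le_trans xy);
  by rewrite lee_fin ge_min lexx ?orbT.
Qed.

Lemma class_box_open_bigU (I : Type) (f : I -> set mm_class) :
  (forall i, class_box_open (f i)) -> class_box_open (\bigcup_i f i).
Proof.
move=> fo x [i _ /fo[e e0 ef]]; exists e => // y /ef fy; by exists i.
Qed.

HB.instance Definition _ := isOpenTopological.Build mm_class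
  class_box_openT class_box_openI class_box_open_bigU.

End mm_class.

Definition hilbert_cube (R : realType) : topologicalType :=
  prod_topology (fun _ : nat => set_type `[0 : R, 1]).

Definition topological_embedding (T U : topologicalType) (f : T -> U) :=
  [/\ injective f, continuous f &
      forall A : set T, open A -> exists2 B : set U, open B & f @` A = range f `&` B].

(* Main.v *)
From HB Require Import structures.
Require Import Defs.
From mathcomp Require Import all_boot all_order all_algebra.
From mathcomp Require Import all_classical all_reals all_analysis.
From mathcomp Require Import zify ring lra.

(* A sequence t in the cube is encoded by the laws mu_t on the natural numbers
   with mu_t(]k, oo[) = 2^-(k+1) (1 - t_k / 4), all on the same discrete metric
   space (nat, max).  Sampling mu_s and mu_t by their quantile functions at the
   same uniform variable couples them with little mass off the diagonal, so
   t |-> (nat, max, mu_t) is continuous.  Conversely the function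
     X |-> sup { mu_X(A) - r | diam A <= k + r }
   is 2-Lipschitz for the box distance and takes the value mu_t([0, k]) at t:
   a set of diameter less than k + 1 is contained in [0, k] or is a single point
   above k, which is too light to matter.  Hence t_k depends
   continuously on the box class, and these functions together form a continuous
   left inverse defined on all of the space of classes, which makes the map an embedding. *)

Set Implicit Arguments.
Unset Strict Implicit.
Unset Printing Implicit Defensive.

Import Order.TTheory GRing.Theory Num.Theory.
Import numFieldNormedType.Exports.
Local Open Scope classical_set_scope.
Local Open Scope ring_scope.

(** * Borel sets and diameters of closures *)

HB.instance Definition _ (T U : ptopologicalType) := Pointed.on (T * U)%type.

Lemma open_borel (T : ptopologicalType) (A : set T) :
  open A -> measurable (A : set (borel T)).
Proof. by move=> oA; apply: sub_gen_smallest. Qed.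

Lemma closed_borel (T : ptopologicalType) (A : set T) :
  closed A -> measurable (A : set (borel T)).
Proof.
move=> cA; rewrite -[A]setCK; apply: (@measurableC _ (borel T)).
by apply: open_borel; exact: closed_openC.
Qed.

Lemma closure_mdist_le (R : realType) (X : metricType R) (A : set X) (d : R) :
  (forall x y, A x -> A y -> mdist x y <= d) ->
  forall x y, closure A x -> closure A y -> mdist x y <= d.
Proof.
move=> Ad x y Ax Ay; apply/ler_addgt0Pr => e e0.
have e2 : 0 < e / 2 by lra.
have [x' [Ax']] := Ax _ (nbhsx_ballx x _ e2).
have [y' [Ay']] := Ay _ (nbhsx_ballx y _ e2).
rewrite !ballEmdist /= => yy' xx'.
have := metric_triangle x x' y; have := metric_triangle x' y' y.
have := Ad _ _ Ax' Ay'; rewrite (metric_sym y' y); lra.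
Qed.

(** * The concentration function and its Lipschitz bound *)

Section concentration.
Context {R : realType}.
Implicit Types (X Y : mmSpace R) (l e : R).

(* The largest mass of a set of diameter at most [l], with the diameter
   constraint relaxed to a penalty so as to be Lipschitz for the box distance. *)
Definition conc l X : R :=
  sup [set a | exists (A : set X) (r : R),
    [/\ measurable (A : set (borel X)), 0 <= r,
        forall x y, A x -> A y -> mdist x y <= l + r
      & a = fine (mm_mu X A) - r]].

Lemma fine_mm_mu_le1 X (A : set X) :
  measurable (A : set (borel X)) -> fine (mm_mu X A) <= 1.
Proof.
move=> mA; rewrite -lee_fin fineK ?fin_num_measure//; exact: probability_le1.
Qed.

Lemma conc_ge l X (A : set X) (r : R) :
  measurable (A : set (borel X)) -> 0 <= r ->
  (forall x y, A x -> A y -> mdist x y <= l + r) ->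
  fine (mm_mu X A) - r <= conc l X.
Proof.
move=> mA r0 Ar; apply: ub_le_sup; last by exists A, r.
exists 1 => _ [B [s [mB s0 _ ->]]].
by rewrite lerBlDr (le_trans (fine_mm_mu_le1 mB)) // lerDl.
Qed.

Lemma conc_le l X b :
  (forall (A : set X) (r : R), measurable (A : set (borel X)) -> 0 <= r ->
    (forall x y, A x -> A y -> mdist x y <= l + r) ->
    fine (mm_mu X A) - r <= b) ->
  conc l X <= b.
Proof.
move=> H; apply: ge_sup; last by move=> _ [A [r [mA r0 Ar ->]]]; exact: H.
exists (fine (mm_mu X set0) - 0), set0, 0; split=> //; exact: measurable0.
Qed.

(** Moving [A] through [S] to [Y] loses mass at most [e] and raises the diameter bound by at most
    [e], which is paid as penalty. A general [Z] serves both couplings and isomorphisms. *)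
Lemma conc_transport (Z : ptopologicalType) X Y (u : Z -> X) (v : Z -> Y)
    (p : {measure set (borel Z) -> \bar R}) (S : set Z) l e :
  continuous u -> continuous v ->
  (forall A, measurable (A : set (borel X)) -> p (u @^-1` A) = mm_mu X A) ->
  (forall B, measurable (B : set (borel Y)) -> p (v @^-1` B) = mm_mu Y B) ->
  0 <= e -> measurable (S : set (borel Z)) -> (p (~` S) <= e%:E)%E ->
  (forall z w, S z -> S w -> mdist (v z) (v w) <= mdist (u z) (u w) + e) ->
  conc l X <= conc l Y + (e + e).
Proof.
move=> cu cv pu pv e0 mS pS uv; apply: conc_le => A r mA r0 Ar.
(* A continuous image of a Borel set may fail to be Borel; its closure is Borel and obeys the same
   diameter bound. *)
pose B := closure (v @` (S `&` u @^-1` A)).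
have mB : measurable (B : set (borel Y)).
  by apply: closed_borel; exact: closed_closure.
have mu : measurable (u @^-1` A : set (borel Z)) by exact: (continuous_borel cu).
have mv : measurable (v @^-1` B : set (borel Z)) by exact: (continuous_borel cv).
have AB : fine (mm_mu X A) <= fine (mm_mu Y B) + e.
  rewrite -lee_fin EFinD !fineK ?fin_num_measure// -pu// -pv//.
  apply: (@le_trans _ _ (p (v @^-1` B `|` ~` S))).
    apply: le_measure; rewrite ?inE//.
      by apply: measurableU => //; exact: measurableC.
    move=> z Az; have [Sz|] := pselect (S z); [left|by right].
    by apply: subset_closure; exists z.
  apply: (le_trans (measureU2 _ mv (measurableC mS))); exact: leeD2l.
have : fine (mm_mu Y B) - (r + e) <= conc l Y.
  apply: conc_ge => //; first exact: addr_ge0.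
  apply: closure_mdist_le => _ _ [z [Sz Az] <-] [w [Sw Aw] <-].
  by have := uv _ _ Sz Sw; have := Ar _ _ Az Aw; lra.
lra.
Qed.

Lemma conc_box X Y l e : (box X Y < e%:E)%E -> `|conc l X - conc l Y| <= e + e.
Proof.
move=> /ereal_inf_lt[_ [p [S [[pX pY] cS ->]]]]; rewrite gt_max => /andP[pS dS].
have e0 : 0 <= e.
  by rewrite -lee_fin (le_trans _ (ltW dS))//; apply: ereal_sup_ubound; left.
have mS : measurable (S : set (borel (X * Y)%type)) by exact: closed_borel.
(* A coupling is only given as a measure; its total mass is read off the first marginal. *)
have pT : p setT = 1%E.
  by rewrite -(probability_setT (mm_mu X)) -pX//; exact: measurableT.
have pCS : (p (~` S) <= e%:E)%E.
  have pSC : p setT = (p S + p (~` S))%E.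
    rewrite -(setvU S) setUC measureU//; [exact: measurableC|exact: setICr].
  have fS : p S \is a fin_num.
    rewrite ge0_fin_numE// (le_lt_trans _ (ltry 1))// -pT.
    by apply: le_measure; rewrite ?inE//; exact: measurableT.
  by rewrite -[p (~` S)](addeK _ fS) [(p (~` S) + _)%E]addeC -pSC pT ltW.
have uv z w : S z -> S w -> `|mdist z.1 w.1 - mdist z.2 w.2| <= e.
  move=> Sz Sw; rewrite -lee_fin (le_trans _ (ltW dS))//.
  by apply: ereal_sup_ubound; right; exists z => //; exists w.
have c1 : continuous (fst : X * Y -> X) by move=> z; exact: cvg_fst.
have c2 : continuous (snd : X * Y -> Y) by move=> z; exact: cvg_snd.
have XY : conc l X <= conc l Y + (e + e).
  apply: (@conc_transport (X * Y)%type _ _ _ _ p S _ _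
    c1 c2 pX pY e0 mS pCS) => z w Sz Sw.
  by have := uv z w Sz Sw; rewrite ler_norml => /andP[]; lra.
have YX : conc l Y <= conc l X + (e + e).
  apply: (@conc_transport (X * Y)%type _ _ _ _ p S _ _
    c2 c1 pY pX e0 mS pCS) => z w Sz Sw.
  by have := uv z w Sz Sw; rewrite ler_norml => /andP[]; lra.
by rewrite ler_norml; apply/andP; split; lra.
Qed.

Lemma conc_mm_iso l X Y : mm_iso X Y -> conc l X = conc l Y.
Proof.
suff H X' Y' : mm_iso X' Y' -> conc l X' <= conc l Y'.
  by move=> XY; apply/le_anti; rewrite !H//; exact: mm_iso_sym.
case=> f [fd _ fm].
(* An isomorphism transports with no error: [Z] is [X'] itself, [S] is everything and [e] is 0. *)
have := @conc_transport X' X' Y' id f (mm_mu X') setT l 0.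
rewrite !addr0; apply=> //.
- by move=> x; exact: cvg_id.
- exact: isometry_continuous.
- by rewrite setCT measure0.
- by move=> z w _ _; rewrite fd addr0.
Qed.

Definition class_conc l (x : mm_class R) : R := conc l (repr x).

Lemma class_conc_of l X : class_conc l (mm_class_of X) = conc l X.
Proof.
by apply: conc_mm_iso; apply/mm_class_ofP; rewrite /mm_class_of reprK.
Qed.

Lemma class_conc_continuous l : continuous (class_conc l).
Proof.
apply/continuousP => V oV.
change (class_box_open (class_conc l @^-1` V)) => x Vx.
have /nbhs_ballP[e e0 eV] : nbhs (class_conc l x) V by apply: open_nbhs_nbhs.
have e4 : 0 < e / 4 by move: e0 => /=; lra.
exists (e / 4) => // y /(conc_box l) xy; apply: eV.
rewrite /ball /=; apply: le_lt_trans xy _; move: e0 => /=; lra.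
Qed.

End concentration.

(** * The discrete space of naturals with the maximum metric *)

Section nat_space.
Context (R : realType).

(** Distances are integers, and a bounded set with at least two points has its largest element as
    diameter. *)
Definition maxdist (m n : nat) : R := (if m == n then 0%N else maxn m n)%:R.

Lemma maxdistxx n : maxdist n n = 0.
Proof. by rewrite /maxdist eqxx. Qed.

Lemma maxdist_positivity m n : maxdist m n = 0 -> m = n.
Proof.
rewrite /maxdist; case: eqP => // mn /eqP.
by rewrite pnatr_eq0 => /eqP; lia.
Qed.

Lemma maxdist_sym m n : maxdist m n = maxdist n m.
Proof. by rewrite /maxdist eq_sym maxnC. Qed.

Lemma maxdist_triangle n m p : maxdist m p <= maxdist m n + maxdist n p.
Proof.
rewrite /maxdist -natrD ler_nat.
by do 3 case: eqP => ?; lia.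
Qed.

Definition nat_space : metricSpace R :=
  MetricSpace 0%N maxdistxx maxdist_positivity maxdist_sym maxdist_triangle.

Lemma nat_space_ball (n : nat_space) : ball n (1 : R) `<=` [set n].
Proof.
move=> m; rewrite ballEmdist /= /mdist /= /maxdist; case: eqP => // nm.
rewrite ltrn1; lia.
Qed.

Lemma nat_space_nbhs1 (n : nat_space) : nbhs n [set n].
Proof. by apply/nbhs_ballP; exists 1 => //=; exact: nat_space_ball. Qed.

Lemma nat_space_nbhs (A : set nat_space) n : A n -> nbhs n A.
Proof. by move=> An; apply: filterS (nat_space_nbhs1 n) => _ ->. Qed.

Lemma nat_space_measurable (A : set (borel nat_space)) : measurable A.
Proof.
apply: open_borel; rewrite openE => n An; exact: (@nat_space_nbhs A).
Qed.

Lemma nat_space_open2 (A : set (nat_space * nat_space)) : open A.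
Proof.
rewrite openE => -[m n] Amn; exists ([set m], [set n]).
  by split; exact: nat_space_nbhs1.
by move=> [m' n'] /= [-> ->].
Qed.

Lemma nat_space_complete : complete_space nat_space.
Proof.
move=> F FF /cauchyP /(_ 1 ltr01)[n Fn]; exists n => A /nbhs_singleton An.
by apply: filterS Fn => m /nat_space_ball ->.
Qed.

Lemma nat_space_separable : separable nat_space.
Proof.
exists setT; first exact: (@countableP nat).
by move=> U [n Un] _; exists n.
Qed.

End nat_space.

(** * The uniform law on the half-open unit interval *)

Section unit_interval.
Context (R : realType).

Definition unif : set (measurableTypeR R) -> \bar R :=
  mrestr (@lebesgue_measure R) (measurable_itv `]0%R, 1%R]).

HB.instance Definition _ := Measure.on unif.

Lemma unif_setT : unif setT = 1%E.
Proof.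
by rewrite /unif /mrestr setTI lebesgue_measure_itv /= lte_fin ltr01 sube0.
Qed.

HB.instance Definition _ := Measure_isProbability.Build _ _ _ unif unif_setT.

Lemma unif_itv (a b : R) :
  0 <= a -> a <= b -> b <= 1 -> unif `]a, b]%classic = (b - a)%:E.
Proof.
move=> a0 ab b1; rewrite /unif /mrestr setIidl; last first.
  by move=> x /=; rewrite !in_itv /=; lra.
rewrite lebesgue_measure_itv /= lte_fin; case: ltP => ab'.
  by rewrite EFinB.
by congr EFin; lra.
Qed.

Lemma unif_eq (A B : set (measurableTypeR R)) :
  (forall w, 0 < w -> w <= 1 -> A w <-> B w) -> unif A = unif B.
Proof.
move=> AB; congr lebesgue_measure; apply/seteqP; split=> w [Hw]/=;
  by rewrite in_itv/= => /andP[w0 w1]; split; rewrite ?in_itv/= ?w0//; apply/AB.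
Qed.

End unit_interval.

(** * Laws on the naturals coded by points of the cube *)

Section cube.
Context (R : realType).
Implicit Types (t s : hilbert_cube R) (w : R).

Definition cube_coord t k : R := set_val (t k).

Lemma cube_coord_itv t k : 0 <= cube_coord t k <= 1.
Proof. by have := set_valP (t k); rewrite /= in_itv. Qed.

Lemma cube_coord_continuous k : continuous (cube_coord ^~ k).
Proof.
move=> t; apply: (@continuous_comp (hilbert_cube R) (set_type `[0 : R, 1]) R
  (fun t : hilbert_cube R => t k) set_val).
  exact: (@proj_continuous nat (fun=> set_type `[0 : R, 1]) k t).
exact: (@initial_continuous (set_type `[0 : R, 1]) R set_val (t k)).
Qed.

(** The factor 1/4 confines the tail at [k] to between 3/4 and 1 times [2^-1 ^+ k.+1]. These ranges
    are disjoint for different [k], so tails decrease strictly whatever the coordinates. *)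
Definition tail t k : R := 2^-1 ^+ k.+1 * (1 - cube_coord t k / 4).

Lemma tail_itv t k : 3 / 4 * 2^-1 ^+ k.+1 <= tail t k <= 2^-1 ^+ k.+1.
Proof.
have : 0 < 2^-1 ^+ k.+1 :> R by rewrite exprn_gt0// invr_gt0.
by rewrite /tail; have /andP[] := cube_coord_itv t k; nra.
Qed.

Lemma tail_gt0 t k : 0 < tail t k.
Proof.
have : 0 < 2^-1 ^+ k.+1 :> R by rewrite exprn_gt0// invr_gt0.
by have /andP[] := tail_itv t k; lra.
Qed.

Lemma tail_le t m n : (m <= n)%N -> tail t n <= tail t m.
Proof.
move: m n; apply/nonincreasing_seqP => k.
have := tail_itv t k; have := tail_itv t k.+1; rewrite (exprS _ k.+1).
have : 0 < 2^-1 ^+ k.+1 :> R by rewrite exprn_gt0// invr_gt0.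
by move=> ? /andP[_ ?] /andP[? _]; lra.
Qed.

Lemma tail_le_half t k : tail t k <= 2^-1.
Proof.
apply: le_trans (tail_le t (leq0n k)) _.
by have /andP[_] := tail_itv t 0%N; rewrite expr1.
Qed.

Lemma tail_cvg0 t w : 0 < w -> exists k, tail t k < w.
Proof.
move=> w0.
have /cvgrPdist_lt /(_ w w0) [k _ /(_ k (leqnn k))] :
    (fun n => 2^-1 ^+ n : R) @ \oo --> (0 : R).
  by apply: cvg_expr; rewrite ger0_norm; lra.
rewrite sub0r normrN ger0_norm ?exprn_ge0 ?invr_ge0// => kw; exists k.
have /andP[_] := tail_itv t k; rewrite exprS.
have : 0 < 2^-1 ^+ k :> R by rewrite exprn_gt0// invr_gt0.
by lra.
Qed.

(* The quantile function of the law on [nat] giving mass [tail t k] to the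
   integers above [k]; the value 0 at [w <= 0] is junk. *)
Definition level t (w : measurableTypeR R) : borel (nat_space R) :=
  if pselect (exists k, tail t k < w) is left h then ex_minn h else 0%N.

(** As tails decrease, the [k] with [tail t k < w] form an up-set, and [level t w] is its least
    element. *)
Lemma level_le t k w : 0 < w -> (level t w <= k)%N = (tail t k < w).
Proof.
move=> w0; rewrite /level; case: pselect => [h|[]]; last exact: tail_cvg0.
case: ex_minnP => m mw mmin; apply/idP/idP => [mk|]; last exact: mmin.
exact: le_lt_trans (tail_le t mk) mw.
Qed.

Lemma level_le0 t w : w <= 0 -> level t w = 0%N.
Proof.
move=> w0; rewrite /level; case: pselect => // h; have [k kw] := h.
exfalso; by have := tail_gt0 t k; lra.
Qed.

Lemma level_measurable t : measurable_fun setT (level t).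
Proof.
pose L n : set (measurableTypeR R) := [set w | (level t w < n)%N].
have mL n : measurable (L n).
  case: n => [|n].
    by rewrite (_ : L 0%N = set0)//; apply/seteqP; split.
  (* The left half-line comes from the junk value 0 of [level]. *)
  rewrite (_ : L n.+1 = `]-oo, 0%R] `|` `]tail t n, +oo[)%classic.
    by apply: measurableU; exact: measurable_itv.
  have tn := tail_gt0 t n; apply/seteqP; split=> w;
    rewrite /L /= !in_itv /= andbT ltnS.
    by have [|w0] := lerP w 0; [left|right; rewrite -level_le].
  by case=> [/(level_le0 t) ->//|nw]; rewrite level_le//; lra.
move=> _ A _; rewrite setTI.
rewrite (_ : _ @^-1` A = \bigcup_(n in A : set nat) (L n.+1 `\` L n)).
  by apply: bigcup_measurable => n _; exact: measurableD.
apply/seteqP; split=> w.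
  by move=> Aw; exists (level t w) => //; split; rewrite /L /= ?ltnn.
case=> n An; rewrite /L /= => -[]; rewrite ltnS => wn /negP.
by rewrite -leqNgt => nw; have -> : level t w = n by apply: anti_leq; rewrite wn.
Qed.

HB.instance Definition _ t :=
  isMeasurableFun.Build _ _ _ _ (level t) (@level_measurable t).

Definition law t := distribution (@unif R) (level t).

Lemma law_full t : supp (law t) = [set: nat_space R].
Proof.
apply/seteqP; split=> // n _ U [oU Un].
have h0 : 0 < 2^-1 ^+ n :> R by rewrite exprn_gt0// invr_gt0.
have h1 : 2^-1 ^+ n <= 1 :> R by rewrite exprn_ile1//; lra.
(* For every [t], this interval lies above [tail t n] and, if [n] is positive, below [tail t n.-1];
   hence [level t] equals [n] on it. *)
apply: (@lt_le_trans _ _ (@unif R `]2^-1 ^+ n.+1, (3/4 * 2^-1 ^+ n)%R]%classic)).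
  have h2 : 2^-1 ^+ n.+1 = 2^-1 * 2^-1 ^+ n :> R by rewrite exprS.
  by rewrite unif_itv ?lte_fin ?h2; lra.
apply: le_measure; rewrite ?inE.
- exact: measurable_itv.
- rewrite -[X in measurable X]setTI; apply: (level_measurable t measurableT).
  exact: nat_space_measurable.
move=> w /=; rewrite in_itv /= exprS => /andP[w1 w2].
suff -> : level t w = n by [].
have w0 : 0 < w by lra.
apply: anti_leq; rewrite level_le//.
have /andP[_] := tail_itv t n; rewrite exprS => tn.
apply/andP; split; first lra.
case: n {U oU Un h0 h1 tn} w1 w2 => // n w1 w2.
rewrite ltnNge level_le// -leNgt.
by have /andP[] := tail_itv t n; lra.
Qed.

Definition mm_of t : mmSpace R :=
  MMSpace (@nat_space_complete R) (@nat_space_separable R) (law_full t).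

End cube.

(** * Continuity into the cube and of the tails *)

Section embedding.
Context (R : realType).
Implicit Types (t s : hilbert_cube R) (w : R).

Lemma cube_continuous (T : topologicalType) (g : T -> hilbert_cube R) :
  (forall k, continuous (fun x => cube_coord (g x) k)) -> continuous g.
Proof.
move=> gc x; apply/cvg_sup => k; move: x.
apply: (@continuous_comp_initial _ _ _
  (fun f : nat -> set_type `[0 : R, 1] => f k)).
apply: (@continuous_comp_initial _ T R (@set_val R `[0 : R, 1]%classic)).
exact: gc.
Qed.

Lemma affine_continuous (T : topologicalType) (f : T -> R) (a b : R) :
  continuous f -> continuous (fun x => a * f x + b).
Proof.
move=> cf x; apply: cvgD; last exact: cst_continuous.
by apply: cvgM; [exact: cst_continuous|exact: cf].
Qed.

(** Finitely many neighbourhoods intersect in a neighbourhood. Only the tails below [N] need this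
    control, since the later ones are uniformly small. *)
Lemma near_upto (T : topologicalType) (f : nat -> T -> R) (N : nat) (d : R)
    (x : T) :
  (forall k, continuous (f k)) -> 0 < d ->
  \forall y \near x, forall k, (k < N)%N -> `|f k x - f k y| <= d.
Proof.
move=> fc d0; have : \forall y \near x, forall k : 'I_N, `|f k x - f k y| <= d.
  by apply: filter_forall => k; have /cvgrPdist_le/(_ _ d0) := fc k x.
by apply: filterS => y xy k kN; exact: (xy (Ordinal kN)).
Qed.

Lemma tail_continuous k : continuous (fun t : hilbert_cube R => tail t k).
Proof.
have -> : (fun t : hilbert_cube R => tail t k) =
    (fun t => - (2^-1 ^+ k.+1 / 4) * cube_coord t k + 2^-1 ^+ k.+1).
  by apply: funext => t; rewrite /tail; ring.
apply: affine_continuous; exact: cube_coord_continuous.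
Qed.

(** * Concentration of the coded laws *)

Lemma law_gt t k : law t [set n : nat | (k < n)%N] = (tail t k)%:E.
Proof.
have tk0 := ltW (tail_gt0 t k); have tk1 := tail_le_half t k.
have -> : law t [set n : nat | (k < n)%N] = @unif R `]0%R, tail t k]%classic.
  apply: unif_eq => w w0 w1 /=.
  by rewrite ltnNge level_le// -leNgt in_itv/= w0.
by rewrite unif_itv ?subr0//; lra.
Qed.

Lemma law_le t k : law t [set n : nat | (n <= k)%N] = (1 - tail t k)%:E.
Proof.
pose A : set (borel (nat_space R)) := [set n : nat | (k < n)%N].
rewrite EFinB -(law_gt t k) -(probability_setC (law t) (nat_space_measurable A)).
apply: (congr1 (law t)); apply/seteqP; split=> n; rewrite /A /=.
  by rewrite leqNgt => /negP.
by move/negP; rewrite -leqNgt.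
Qed.

Lemma conc_mm_of t k : conc k%:R (mm_of t) = 1 - tail t k.
Proof.
have th := tail_le_half t k; have t0 := tail_gt0 t k.
have mN (A : set (borel (nat_space R))) : measurable A := nat_space_measurable A.
apply/le_anti/andP; split; last first.
  have -> : 1 - tail t k = fine (mm_mu (mm_of t) [set n : nat | (n <= k)%N]) - 0.
    by rewrite subr0 -[LHS]/(fine (1 - tail t k)%:E) -law_le.
  apply: conc_ge => // m n /= mk nk; rewrite addr0 /mdist/= /maxdist ler_nat.
  by case: eqP => // _; rewrite geq_max mk.
apply: conc_le => A r mA r0 Ar.
(* A penalty of at least 1 leaves no positive value; a smaller one gains nothing, distances being
   integers. *)
have [r1|r1] := leP 1 r; first by have := fine_mm_mu_le1 mA; lra.
have mono B b : (A `<=` B) -> law t B = b%:E -> fine (mm_mu (mm_of t) A) <= b.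
  move=> AB tB; rewrite -lee_fin fineK ?fin_num_measure// -tB.
  by apply: le_measure; rewrite ?inE.
suff : fine (mm_mu (mm_of t) A) <= 1 - tail t k by lra.
(* If [A] meets [[0, k]], a point [n] of [A] above [k] would be at distance [n > k + r] from it.
   Otherwise [A] lies above [k] and has mass at most [tail t k], which is at most 1/2 and so at most
   [1 - tail t k]. *)
have [[m Am mk]|nA] := pselect (exists2 m : nat, A m & (m <= k)%N).
  apply: mono (law_le t k) => n An /=; rewrite leqNgt; apply/negP => kn.
  have := Ar _ _ Am An; rewrite /mdist/= /maxdist.
  have -> : (m == n :> nat) = false by lia.
  have -> : maxn m n = n by lia.
  suff : k.+1%:R <= n%:R :> R by rewrite -natr1; lra.
  by rewrite ler_nat.
apply: le_trans (mono _ _ _ (law_gt t k)) _; last by lra.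
by move=> n An /=; rewrite ltnNge; apply/negP => nk; apply: nA; exists n.
Qed.

(** * The quantile coupling and continuity of the encoding *)

Definition levels s t w : borel (nat_space R * nat_space R)%type :=
  (level s w, level t w).

Lemma levels_measurable s t :
  measurable_fun setT (levels s t : measurableTypeR R -> _).
Proof.
have mlevel u n : measurable (level u @^-1` [set n] : set (measurableTypeR R)).
  rewrite -[X in measurable X]setTI; apply: level_measurable => //.
  exact: nat_space_measurable.
move=> _ A _; rewrite setTI.
rewrite (_ : _ @^-1` A =
    \bigcup_(m in @setT nat) \bigcup_(n in [set n : nat | A (m, n)])
    (level s @^-1` [set m : nat] `&` level t @^-1` [set n : nat])).
  apply: bigcup_measurable => m _; apply: bigcup_measurable => n _.
  exact: measurableI.
apply/seteqP; split=> w.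
  by move=> Aw; exists (level s w) => //; exists (level t w).
by case=> m _ [n /= Amn [wm wn]]; rewrite /levels wm wn.
Qed.

(** The joint law of the two levels is a coupling. The diagonal has distortion 0, both spaces having
    the same metric, and its complement has the mass assumed small. *)
Lemma box_mm_of s t e : 0 < e ->
  (@unif R [set w | level s w <> level t w] < e%:E)%E ->
  (box (mm_of s) (mm_of t) < e%:E)%E.
Proof.
move=> e0 st.
pose D : set (mm_of s * mm_of t) := [set z : nat * nat | z.1 = z.2].
pose p : {measure set (borel (mm_of s * mm_of t)%type) -> \bar R} :=
  @measure_function_pushforward__canonical__measure_function_Measure
    _ _ (measurableTypeR R) (borel (nat_space R * nat_space R)%type) _
    (@unif R) (levels s t) (@levels_measurable s t).
have mN (A : set (borel (nat_space R * nat_space R)%type)) : measurable A.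
  by apply: open_borel; exact: nat_space_open2.
have mp A : measurable (levels s t @^-1` A : set (measurableTypeR R)).
  by rewrite -[X in measurable X]setTI; apply: levels_measurable.
apply: (@le_lt_trans _ _ (maxe (1 - p D) (dis D))%E).
  apply: ereal_inf_lbound; exists p, D; split=> //.
  by rewrite -[D]setCK; apply/open_closedC/nat_space_open2.
rewrite gt_max; apply/andP; split.
  by rewrite -(probability_setC (@unif R)).
apply: (@le_lt_trans _ _ 0%E); last by rewrite lte_fin.
apply: ge_ereal_sup => _ [->//|[[m m'] /= mm' [[n n'] /= nn' <-]]].
move: mm' nn'; rewrite /D /= => -> ->.
by rewrite /mdist /= subrr normr0.
Qed.

Lemma level_lt s t w : 0 < w -> (level s w < level t w)%N ->
  tail s (level s w) < w <= tail t (level s w).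
Proof. by move=> w0 st; rewrite -level_le// leqnn leNgt -level_le// -ltnNge. Qed.

Lemma unif_level_neq s t N (d : R) :
  (forall k, (k < N)%N -> `|tail s k - tail t k| <= d) ->
  (@unif R [set w | level s w <> level t w] <= (d *+ N + 2^-1 ^+ N.+1)%:E)%E.
Proof.
move=> std.
(* [w] separates [tail s m] from [tail t m] for [m] the smaller of the two
   levels: [F m] covers the case [m < N] and [F N] the case [N <= m]. *)
pose F k : set (measurableTypeR R) := (if k == N then `]0%R, 2^-1 ^+ N.+1]
  else `]Num.min (tail s k) (tail t k), Num.max (tail s k) (tail t k)])%classic.
pose E := [set w | level s w <> level t w].
have mF k : measurable (F k) by rewrite /F; case: eqP => _; exact: measurable_itv.
have mE : measurable (E : set (measurableTypeR R)).
  rewrite -[X in measurable X]setTI.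
  apply: (@levels_measurable s t measurableT [set z : nat * nat | z.1 <> z.2]).
  by apply: open_borel; exact: nat_space_open2.
pose I01 : set (measurableTypeR R) := `]0%R, 1%R]%classic.
have -> : unif E = @unif R (E `&` I01).
  apply: unif_eq => w w0 w1; split=> [Ew|[]//]; split=> //.
  by rewrite /I01/= in_itv/= w0.
have h0 : 0 < 2^-1 ^+ N.+1 :> R by rewrite exprn_gt0// invr_gt0.
have h1 : 2^-1 ^+ N.+1 <= 1 :> R by rewrite exprn_ile1//; lra.
(* The pair [u], [v] stands for [s], [t] in either order, according to which level is smaller. *)
have FE u v w : 0 < w -> (level u w < level v w)%N ->
    (forall k, `]tail u k, tail v k]%classic `<=`
       `]Num.min (tail s k) (tail t k), Num.max (tail s k) (tail t k)]%classic) ->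
    (\big[setU/set0]_(k < N.+1) F k) w.
  move=> w0 uv uvF; have := level_lt w0 uv; set m := level u w => wm.
  rewrite -bigcup_mkord; have [mN|Nm] := ltnP m N.
    exists m => /=; first by lia.
    by rewrite /F ltn_eqF//; apply: uvF; rewrite /= in_itv/=.
  (* Here [w <= tail v m <= tail v N <= 2^-1 ^+ N.+1]. *)
  exists N => //=; rewrite /F eqxx /= in_itv/= w0.
  have := tail_le v Nm; have /andP[_] := tail_itv v N.
  by move/andP: wm => [_]; lra.
apply: le_trans
  (@content_subadditive _ _ _ (@unif R) (E `&` I01) F N.+1 _ _ _) _.
- by move=> k _; exact: mF.
- by apply: measurableI => //; exact: measurable_itv.
- move=> w [/= Ew]; rewrite /I01/= in_itv/= => /andP[w0 _].
  have : (level s w < level t w)%N || (level t w < level s w)%N.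
    by rewrite -neq_ltn; apply/eqP.
  by case/orP => lt; apply: (FE _ _ _ w0 lt) => k x;
    rewrite /= !in_itv/= gt_min le_max => /andP[-> ->]; rewrite ?orbT.
rewrite big_ord_recr/= EFinD; apply: leeD; last first.
  by rewrite /F eqxx unif_itv ?subr0// ltW.
rewrite -[N in d *+ N]card_ord -sumr_const -sumEFin.
apply: lee_sum => -[k kN] _ /=.
rewrite /F ltn_eqF// unif_itv.
- rewrite lee_fin; have := std _ kN; rewrite ler_norml.
  by rewrite /Num.max /Num.min; case: ltP => _ /andP[]; lra.
- by rewrite le_min !ltW// tail_gt0.
- by rewrite ge_min !le_max lexx.
- by rewrite ge_max; have := tail_le_half s k; have := tail_le_half t k; lra.
Qed.

Lemma mm_of_continuous :
  continuous (fun t : hilbert_cube R => mm_class_of (mm_of t)).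
Proof.
apply/continuousP => U.
change (class_box_open U -> open (fun t => U (mm_class_of (mm_of t)))) => oU.
rewrite openE => t /oU[e e0 eU].
have e2 : 0 < e / 2 by lra.
have [N Ne] := tail_cvg0 t e2.
(* From [3/4 * 2^-1 ^+ N.+1 <= tail t N < e / 2]. With [d *+ N <= e / 4] the total stays below
   [e * (11 / 12)]. *)
have hN : 2^-1 ^+ N.+1 < e * (2 / 3).
  by have /andP[] := tail_itv t N; lra.
pose d := e / 4 / N.+1%:R.
have d0 : 0 < d by rewrite divr_gt0//; lra.
have dN : d *+ N <= e / 4.
  rewrite -mulr_natr /d -mulrA ler_piMr//; first by lra.
  by rewrite mulrC ler_pdivrMr// mul1r ler_nat.
have := near_upto (f := fun k s => tail s k) N t (@tail_continuous) d0.
apply: filterS => s ts; apply: eU; rewrite class_boxE; apply: box_mm_of => //.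
apply: le_lt_trans (unif_level_neq ts) _.
by rewrite lte_fin; lra.
Qed.

(** * The continuous left inverse *)

Lemma clamp_itv (x : R) : Num.max 0 (Num.min 1 x) \in `[0 : R, 1]%classic.
Proof.
by rewrite inE /= in_itv/= le_max lexx/= ge_max ler01/= ge_min lexx.
Qed.

(** Truncation makes [recover] defined on every class, including those outside the image of the
    cube. *)
Definition clamp (x : R) : set_type `[0 : R, 1]%classic :=
  exist (fun y => y \in `[0 : R, 1]%classic) _ (clamp_itv x).

Lemma clamp_id (x : R) : 0 <= x <= 1 -> set_val (clamp x) = x.
Proof.
move=> /andP[x0 x1]; rewrite set_valE/=.
by rewrite (min_idPr x1) (max_idPr x0).
Qed.

Lemma clamp_continuous (T : topologicalType) (f : T -> R) :
  continuous f -> continuous (fun x => set_val (clamp (f x))).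
Proof.
move=> cf x; rewrite /continuous_at !set_valE/=.
apply: (@continuous_max R T (fun=> 0)); first exact: cst_continuous.
by apply: (@continuous_min R T (fun=> 1)); [exact: cst_continuous|exact: cf].
Qed.

(** Solves [conc = 1 - tail] for the coordinate [k]. *)
Definition recover (x : mm_class R) : hilbert_cube R :=
  fun k => clamp (4 * (1 - 2 ^+ k.+1 * (1 - class_conc k%:R x))).

Lemma recoverK t : recover (mm_class_of (mm_of t)) = t.
Proof.
apply: functional_extensionality_dep => k; apply: val_inj.
have tk := cube_coord_itv t k.
rewrite /recover class_conc_of conc_mm_of.
suff -> : 4 * (1 - 2 ^+ k.+1 * (1 - (1 - tail t k))) = cube_coord t k.
  by have := clamp_id tk; rewrite /cube_coord !set_valE.
rewrite subKr /tail mulrA -exprMn divff// expr1n mul1r.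
lra.
Qed.

Lemma recover_continuous : continuous recover.
Proof.
apply: cube_continuous => k; apply: clamp_continuous.
have -> : (fun x : mm_class R =>
      4 * (1 - 2 ^+ k.+1 * (1 - class_conc k%:R x))) =
    (fun x => 4 * 2 ^+ k.+1 * class_conc k%:R x + 4 * (1 - 2 ^+ k.+1)).
  by apply: funext => x; ring.
apply: affine_continuous; exact: class_conc_continuous.
Qed.

End embedding.

Theorem theorem2 (R : realType) :
  exists f : hilbert_cube R -> mm_class R, topological_embedding f.
Proof.
exists (fun t => mm_class_of (mm_of t)); split.
- exact: can_inj (@recoverK R).
- exact: mm_of_continuous.
(* On the range, [recover] undoes the encoding, so this preimage cuts out exactly the image of
   [A]. *)
- move=> A oA; exists (@recover R @^-1` A).
    by apply: open_comp => // x _; exact: recover_continuous.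
  apply/seteqP; split=> [_ [t At <-]|_ [[t _ <-]]]; rewrite /= recoverK.
    by split=> //; exists t.
  by move=> At; exists t.
Qed.
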